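(* Let $R$ be a left Zacharias domain, $\mathsf R$ a multivariate Ore extension of $R$ in which each $\alpha_i$ is an automorphism of $R$, and $F=\{g_1,\dots,g_u\}\subset\mathsf R^m\setminus\{0\}$ a finite set with $\mathbf M(g_i)=c_i\tau_i\mathbf e_{l_i}$. Let $\mathsf T$ be the set of all terms $\mathbf T(H)=\mathrm{lcm}(\tau_i:i\in H)\,\mathbf e_{l}$, where $H$ ranges over the nonempty subsets of $\{1,\dots,u\}$ on which $i\mapsto l_i$ is constant, with value $l$. For each $\mathsf m=\delta\epsilon\in\mathsf T$ ($\delta\in\mathcal T$, $\epsilon\in\{\mathbf e_1,\dots,\mathbf e_m\}$) and each $i$ let $$t_i(\mathsf m)=\begin{cases}\delta/\tau_i&\text{if }\mathbf T(g_i)\mid\mathsf m\\0&\text{otherwise}\end{cases},\qquad v(\mathsf m)_i=\begin{cases}\alpha_{t_i(\mathsf m)}(c_i)&\text{if }\mathbf T(g_i)\mid\mathsf m\\0&\text{otherwise,}\end{cases}$$ let $C(\mathsf m)\subset R^u$ be a finite generating set of the left $R$-module $\{(d_1,\dots,d_u)\in R^u:\sum_id_iv(\mathsf m)_i=0\}$, and let $S(\mathsf m)=\{(d_1t_1(\mathsf m),\dots,d_ut_u(\mathsf m)):(d_1,\dots,d_u)\in C(\mathsf m)\}$. Then $\mathcal S(F):=\bigcup_{\mathsf m\in\mathsf T}S(\mathsf m)$ is a left Gebauer–Möller set for $F$.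
   Context: **Ore extensions.** $R$ is a (not necessarily commutative) domain with identity. A multivariate Ore extension $\mathsf R=R[Y_1;\alpha_1,\delta_1]\cdots[Y_n;\alpha_n,\delta_n]$ is an iterated Ore extension ($Y_i\star r=\alpha_i(r)Y_i+\delta_i(r)$, $\alpha_i$ an injective ring endomorphism mapping $R$ to $R$, $\delta_i$ an $\alpha_i$-derivation mapping $R$ to $R$) such that $\alpha_j\delta_i=\delta_i\alpha_j$ for $i\ne j$, $\alpha_i\alpha_j=\alpha_j\alpha_i$, $\delta_i\delta_j=\delta_j\delta_i$, and $\alpha_j(Y_i)=Y_i$, $\delta_j(Y_i)=0$ for $i<j$. Its multiplication is $\star$. It is a free left $R$-module on the set of terms $\mathcal T=\{Y_1^{a_1}\cdots Y_n^{a_n}\}$, a commutative monoid. For $\tau=Y_1^{a_1}\cdots Y_n^{a_n}$ put $\alpha_\tau=\alpha_1^{a_1}\cdots\alpha_n^{a_n}:R\to R$. The associated graded Ore extension $\mathsf S=R[Y_1;\alpha_1]\cdots[Y_n;\alpha_n]$ is the same left $R$-module with multiplication $\ast$ determined by $(a\tau)\ast(b\omega)=a\,\alpha_\tau(b)\,\tau\omega$. **Orderings.** $\mathsf R^m$ has canonical basis $\mathbf e_1,\dots,\mathbf e_m$ and terms $\mathcal T^{(m)}=\{t\mathbf e_i\}$; $\tau\mathbf e_i\mid\omega\mathbf e_j$ means $i=j$ and $\tau\mid\omega$. A term ordering $<$ on $\mathcal T^{(m)}$ compatible with one on $\mathcal T$ is fixed; $\mathbf T(f)$, $\mathrm{lc}(f)$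 and $\mathbf M(f)=\mathrm{lc}(f)\mathbf T(f)$ are maximal term, leading coefficient and maximal monomial. **Gebauer–Möller sets.** Let $e_1,\dots,e_u$ be the canonical basis of $\mathsf S^u$ and $\mathfrak s_L:\mathsf S^u\to\mathsf S^m$, $\mathfrak s_L(\sum h_ie_i)=\sum h_i\ast\mathbf M(g_i)$. An element $\sum a_i\lambda_ie_i$ ($a_i\in R,\lambda_i\in\mathcal T$) is $\mathcal T^{(m)}$-homogeneous if $\lambda_i\mathbf T(g_i)$ is the same term for all $i$ with $a_i\ne0$ (zero is allowed as an element of a generating set). A left Gebauer–Möller set for $F$ is a set of $\mathcal T^{(m)}$-homogeneous generators of the left $\mathsf S$-module $\ker(\mathfrak s_L)$. **Zacharias ring.** A ring $R$ with identity is a left Zacharias ring if (a) it is noetherian; (b) there is an algorithm which, given $c\in R^m$ and a finite $C=\{c_1,\dots,c_t\}\subset R^m\setminus\{0\}$, decides whether $c$ lies in the left module generated by $C$ and, if so, produces $d_i\in R$ with $c=\sum d_ic_i$; (c) there is an algorithm which, given $\{c_1,\dots,c_t\}\subset R^m\setminus\{0\}$, computes a finite set of generators of the left syzygy module $\{(d_1,\dots,d_t)\in R^t:\sum d_ic_i=0\}$. *)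

(* Defs.v *)
From HB Require Import structures.
From mathcomp Require Import all_boot all_order all_algebra.
From mathcomp Require Export mpoly.

Set Implicit Arguments.
Unset Strict Implicit.
Unset Printing Implicit Defensive.

Import GRing.Theory.
Local Open Scope ring_scope.

Section LeftModules.
Context (K : nzRingType) (V : lmodType K).

Definition left_span (G : V -> Prop) (x : V) : Prop :=
  exists s : seq (K * V),
    (forall p, p \in s -> G p.2) /\ x = \sum_(p <- s) p.1 *: p.2.

Definition generates (G M : V -> Prop) : Prop :=
  forall x, M x <-> left_span G x.

End LeftModules.

Definition domain (R : nzRingType) : Prop := GRing.integral_domain_axiom R.

Definition left_noetherian (R : nzRingType) : Prop :=
  forall I : R -> Prop,
    I 0 -> (forall x y, I x -> I y -> I (x + y)) ->
    (forall r x, I x -> I (r * x)) ->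
  exists s : seq R, generates (V := R^o) (fun x => x \in s) I.

(* The two algorithms are data: functions returning, with their output, its   *)
(* correctness. Left modules R^m are the row vectors 'rV[R]_m.                *)
Record left_zacharias (R : nzRingType) : Type := LeftZacharias {
  zach_noetherian : left_noetherian R;
  zach_member : forall (m t : nat) (c : 'rV[R]_m) (C : 'I_t -> 'rV[R]_m),
    (forall i, C i != 0) ->
    {d : 'I_t -> R | c = \sum_i d i *: C i}
    + {~ exists d : 'I_t -> R, c = \sum_i d i *: C i};
  zach_syzygies : forall (m t : nat) (C : 'I_t -> 'rV[R]_m),
    (forall i, C i != 0) ->
    {G : seq 'rV[R]_t
      | generates (fun d => d \in G) (fun d => \sum_i d 0 i *: C i = 0)}
}.

(* The Ore extension R[Y_1; alpha_1, delta_1]...[Y_n; alpha_n, delta_n].      *)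
Record ore_data (R : nzRingType) (n : nat) := OreData {
  alpha : 'I_n -> {rmorphism R -> R};
  delta : 'I_n -> {additive R -> R};
  alpha_inj : forall i, injective (alpha i);
  delta_derivation : forall i a b,
    delta i (a * b) = alpha i a * delta i b + delta i a * b;
  alphaC : forall i j a, alpha i (alpha j a) = alpha j (alpha i a);
  deltaC : forall i j a, delta i (delta j a) = delta j (delta i a);
  alpha_deltaC : forall i j, i != j ->
    forall a, alpha j (delta i a) = delta i (alpha j a)
}.

(* mnm_iter f (a_1, ..., a_n) is f_1^{a_1} o ... o f_n^{a_n}.                 *)
Definition mnm_iter (n : nat) (X : Type) (f : 'I_n -> X -> X)
    (m : 'X_{1..n}) (x : X) : X :=
  foldr (fun i y => iter (m i) (f i) y) x (enum 'I_n).

Definition alphaT (R : nzRingType) (n : nat) (D : ore_data R n)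
    (t : 'X_{1..n}) : R -> R :=
  mnm_iter (fun i => alpha D i : R -> R) t.

(* The free left R-module on the terms; of the structures on {mpoly R[n]}     *)
(* only that of a left R-module is kept, and 'X_[t] is the term t.            *)
Definition ore_ext (R : nzRingType) (n : nat) (D : ore_data R n) : Type :=
  {mpoly R[n]}.

Section OreExtension.
Context (R : nzRingType) (n : nat) (D : ore_data R n).

HB.instance Definition _ := GRing.Lmodule.copy (ore_ext D) {mpoly R[n]}.

Implicit Types (f g h : ore_ext D) (t : 'X_{1..n}).

Definition ore_term t : ore_ext D := 'X_[R, t].

(* The action of Y_i, that is, the sum of the (c t) |-> (Y_i * c) t over the  *)
(* monomials c t of the argument, where Y_i * c = alpha_i(c) Y_i + delta_i(c).*)
(* It encodes alpha_j(Y_i) = Y_i and delta_j(Y_i) = 0: the Y_i commute.       *)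
Definition ore_lmulY (i : 'I_n) f : ore_ext D :=
  \sum_(t <- msupp f)
    (alpha D i f@_t *: ore_term (t + U_(i))%MM + delta D i f@_t *: ore_term t).

Definition ore_mul f g : ore_ext D :=
  \sum_(t <- msupp f) f@_t *: mnm_iter ore_lmulY t g.

Section Lift.
Context (G : 'X_{1..n} -> R -> ore_ext D).
Hypothesis GD : forall t a b, G t (a + b) = G t a + G t b.

Let lift (f : ore_ext D) := \sum_(t <- msupp f) G t f@_t.

Let G0 t : G t 0 = 0.
Proof. by apply: (addrI (G t 0)); rewrite -GD !addr0. Qed.

Let lift_widen f (s : seq 'X_{1..n}) : uniq s -> {subset msupp f <= s} ->
  lift f = \sum_(t <- s) G t f@_t.
Proof.
move=> us fs; rewrite (bigID (fun t => t \in msupp f)) /= [X in _ + X]big1.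
  rewrite addr0 -big_filter; apply: perm_big; apply: uniq_perm => //.
    exact: filter_uniq.
  by move=> t; rewrite mem_filter; case: (boolP (t \in msupp f)) => // /fs ->.
by move=> t /memN_msupp_eq0 ->.
Qed.

Lemma lift_add f g : lift (f + g) = lift f + lift g.
Proof.
pose s := undup (msupp f ++ msupp g).
have us : uniq s by exact: undup_uniq.
rewrite !(@lift_widen _ s) // -?big_split /=.
- by apply: eq_bigr => t _; rewrite [(f + g)@_t]mcoeffD GD.
- by move=> t tg; rewrite mem_undup mem_cat tg orbT.
- by move=> t tf; rewrite mem_undup mem_cat tf.
- by move=> t /msuppD_le; rewrite mem_undup.
Qed.

Lemma lift_term c t : lift (c *: ore_term t) = G t c.
Proof.
rewrite (@lift_widen _ [:: t]) ?big_seq1 //.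
  by rewrite [(_ *: _)@_t]mcoeffZ mcoeffX eqxx mulr1.
by move=> t' /msuppZ_le; rewrite msuppX.
Qed.

End Lift.

Lemma ore_ind (P : ore_ext D -> Prop) :
  P 0 -> (forall f g, P f -> P g -> P (f + g)) ->
  (forall c t, P (c *: ore_term t)) -> forall f, P f.
Proof.
move=> P0 PD PX f; rewrite [f](mpolyE f).
by elim/big_ind: _ => // t _; exact: PX.
Qed.

Lemma ore_lmulYD i f g :
  ore_lmulY i (f + g) = ore_lmulY i f + ore_lmulY i g.
Proof.
apply: (@lift_add (fun t c => alpha D i c *: ore_term (t + U_(i))%MM
                             + delta D i c *: ore_term t)).
by move=> t a b; rewrite !raddfD !scalerDl addrACA.
Qed.

Lemma ore_lmulY_term i c t : ore_lmulY i (c *: ore_term t) =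
  alpha D i c *: ore_term (t + U_(i))%MM + delta D i c *: ore_term t.
Proof.
apply: (@lift_term (fun t c => alpha D i c *: ore_term (t + U_(i))%MM
                              + delta D i c *: ore_term t)).
by move=> {}t a b; rewrite !raddfD !scalerDl addrACA.
Qed.

Lemma ore_lmulY0 i : ore_lmulY i 0 = 0.
Proof. by apply: (addrI (ore_lmulY i 0)); rewrite -ore_lmulYD !addr0. Qed.

Lemma ore_lmulYZ i c f :
  ore_lmulY i (c *: f) = alpha D i c *: ore_lmulY i f + delta D i c *: f.
Proof.
elim/ore_ind: f => [|f g IHf IHg|d t].
- by rewrite !scaler0 ore_lmulY0 !scaler0 addr0.
- by rewrite !scalerDr !ore_lmulYD !scalerDr IHf IHg addrACA.
rewrite scalerA !ore_lmulY_term delta_derivation rmorphM scalerDr !scalerA.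
by rewrite scalerDl addrA.
Qed.

Lemma ore_lmulYC i j f :
  ore_lmulY i (ore_lmulY j f) = ore_lmulY j (ore_lmulY i f).
Proof.
have [->//|ij] := eqVneq i j.
elim/ore_ind: f => [|f g IHf IHg|c t]; first by rewrite !ore_lmulY0.
  by rewrite !ore_lmulYD IHf IHg.
rewrite !ore_lmulY_term !ore_lmulYD !ore_lmulY_term.
rewrite (alphaC D i j) (deltaC D i j) -(alpha_deltaC D ij).
rewrite (@alpha_deltaC _ _ D j i) 1?eq_sym //.
by rewrite -!addmA (addmC U_(j)%MM) addrACA.
Qed.

Section Iter.
Context (X : Type) (F : 'I_n -> X -> X).
Hypothesis FC : forall i j x, F i (F j x) = F j (F i x).

Lemma iterFC i j k x : F i (iter k (F j) x) = iter k (F j) (F i x).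
Proof. by elim: k => //= k IH; rewrite FC IH. Qed.

Lemma mnm_iterS i t x : mnm_iter F (t + U_(i))%MM x = F i (mnm_iter F t x).
Proof.
rewrite /mnm_iter.
have := mem_enum 'I_n i; have := enum_uniq 'I_n.
elim: (enum 'I_n) => [|j s IHs] //=; rewrite inE => /andP[js us].
have [ij _|ij /= si] := eqVneq i j.
  subst j; rewrite mnmDE mnm1E eqxx addn1 /=; congr (F i (iter _ _ _)).
  elim: s js {us IHs} => //= j s IHs; rewrite inE negb_or => /andP[ij si].
  by rewrite IHs // mnmDE mnm1E (negPf ij) addn0.
by rewrite IHs // mnmDE mnm1E (negPf ij) addn0 iterFC.
Qed.

Lemma mnm_iter0 x : mnm_iter F 0%MM x = x.
Proof. by rewrite /mnm_iter; elim: (enum _) => //= i s ->; rewrite mnm0E. Qed.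

End Iter.

Lemma mnm_ind (P : 'X_{1..n} -> Prop) :
  P 0%MM -> (forall i t, P t -> P (t + U_(i))%MM) -> forall t, P t.
Proof.
move=> P0 PS t; move: {2}(mdeg t) (erefl (mdeg t)) => k.
elim: k t => [|k IHk] t; first by move/eqP; rewrite mdeg_eq0 => /eqP ->.
move=> tk; have [i ti] : exists i, t i != 0%N.
  apply/existsP; apply: contra_eqT tk => /existsPn t0.
  by rewrite mdegE big1 // => i _; apply/eqP; move/negPn: (t0 i).
have le_it : (U_(i) <= t)%MM by rewrite lep1mP.
rewrite -(submK le_it); apply/PS/IHk.
by move: tk; rewrite -{1}(submK le_it) mdegD mdeg1 addn1 => -[].
Qed.

Lemma ore_mulDl : left_distributive ore_mul +%R.
Proof.
move=> f g h.
apply: (@lift_add (fun t c => c *: mnm_iter ore_lmulY t h)).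
by move=> t a b; rewrite scalerDl.
Qed.

Lemma ore_mul_term c t h :
  ore_mul (c *: ore_term t) h = c *: mnm_iter ore_lmulY t h.
Proof.
apply: (@lift_term (fun t c => c *: mnm_iter ore_lmulY t h)).
by move=> {}t a b; rewrite scalerDl.
Qed.

Lemma ore_mul0r h : ore_mul 0 h = 0.
Proof. by rewrite /ore_mul msupp0 big_nil. Qed.

Lemma mnm_iter_lmulYD t f g : mnm_iter ore_lmulY t (f + g) =
  mnm_iter ore_lmulY t f + mnm_iter ore_lmulY t g.
Proof.
elim/mnm_ind: t => [|i t IHt]; first by rewrite !mnm_iter0.
by rewrite !(mnm_iterS ore_lmulYC) IHt ore_lmulYD.
Qed.

Lemma ore_mulDr : right_distributive ore_mul +%R.
Proof.
move=> f g h; rewrite /ore_mul -big_split; apply: eq_bigr => t _ /=.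
by rewrite mnm_iter_lmulYD scalerDr.
Qed.

Lemma ore_scalerAl c f g : c *: ore_mul f g = ore_mul (c *: f) g.
Proof.
elim/ore_ind: f => [|f h IHf IHh|d t]; rewrite ?(ore_mul0r, scaler0) //.
  by rewrite ore_mulDl !scalerDr ore_mulDl IHf IHh.
by rewrite scalerA !ore_mul_term scalerA.
Qed.

Lemma ore_lmulY_mul i f g : ore_mul (ore_lmulY i f) g = ore_lmulY i (ore_mul f g).
Proof.
elim/ore_ind: f => [|f h IHf IHh|c t].
- by rewrite ore_lmulY0 !ore_mul0r ore_lmulY0.
- by rewrite ore_lmulYD !ore_mulDl ore_lmulYD IHf IHh.
rewrite ore_lmulY_term ore_mulDl !ore_mul_term ore_lmulYZ.
by rewrite (mnm_iterS ore_lmulYC).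
Qed.

Lemma ore_mulA : associative ore_mul.
Proof.
move=> f g h; elim/ore_ind: f => [|f k IHf IHk|c t]; rewrite ?ore_mul0r //.
  by rewrite !ore_mulDl IHf IHk.
rewrite !ore_mul_term -ore_scalerAl; congr (_ *: _).
elim/mnm_ind: t => [|i t IHt]; first by rewrite !mnm_iter0.
by rewrite !(mnm_iterS ore_lmulYC) ore_lmulY_mul IHt.
Qed.

Definition ore_one : ore_ext D := ore_term 0%MM.

Lemma ore_mul1r : left_id ore_one ore_mul.
Proof.
by move=> f; rewrite -[ore_one]scale1r ore_mul_term mnm_iter0 scale1r.
Qed.

Lemma delta1 i : delta D i 1 = 0.
Proof.
have := delta_derivation D i 1 1; rewrite !mulr1 rmorph1 mul1r => e.
by apply: (addrI (delta D i 1)); rewrite addr0 -e.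
Qed.

Lemma mnm_iter_lmulY_term s t :
  mnm_iter ore_lmulY s (ore_term t) = ore_term (s + t)%MM.
Proof.
elim/mnm_ind: s => [|i s IHs]; first by rewrite mnm_iter0 add0m.
rewrite (mnm_iterS ore_lmulYC) IHs -[ore_term _]scale1r ore_lmulY_term.
by rewrite rmorph1 delta1 scale0r addr0 scale1r -!addmA (addmC t).
Qed.

Lemma ore_mulr1 : right_id ore_one ore_mul.
Proof.
move=> f; elim/ore_ind: f => [|f g IHf IHg|c t]; rewrite ?ore_mul0r //.
  by rewrite ore_mulDl IHf IHg.
by rewrite ore_mul_term mnm_iter_lmulY_term addm0.
Qed.

Lemma ore_one_neq0 : ore_one != 0.
Proof. by rewrite /ore_one /ore_term mpolyX0; exact: oner_neq0. Qed.

HB.instance Definition _ := GRing.Zmodule_isNzRing.Build (ore_ext D)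
  ore_mulA ore_mul1r ore_mulr1 ore_mulDl ore_mulDr ore_one_neq0.
HB.instance Definition _ :=
  GRing.Lmodule_isLalgebra.Build R (ore_ext D) ore_scalerAl.

Lemma ore_termM s t : ore_term s * ore_term t = ore_term (s + t)%MM.
Proof.
by rewrite -[ore_term s]scale1r [LHS]ore_mul_term mnm_iter_lmulY_term scale1r.
Qed.

Lemma ore_YC (i : 'I_n) (r : R) :
  ore_term U_(i)%MM * r%:A = (alpha D i r)%:A * ore_term U_(i)%MM
                             + (delta D i r)%:A.
Proof.
rewrite -!scalerAl !mul1r -[ore_term U_(i)]scale1r [LHS]ore_mul_term !scale1r.
rewrite -{1}(add0m U_(i)%MM) (mnm_iterS ore_lmulYC) mnm_iter0 ore_lmulY_term.
by rewrite add0m.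
Qed.

Lemma ore_termE t : ore_term t = \prod_(i < n) ore_term U_(i)%MM ^+ t i.
Proof.
have termX i k : ore_term U_(i)%MM ^+ k = ore_term (U_(i) *+ k)%MM.
  elim: k => [|k IHk]; first by rewrite mulm0n.
  by rewrite exprS IHk ore_termM mulmS.
rewrite {1}(multinomUE_id t) (big_morph ore_term (id1 := 1) (op1 := *%R)) //.
- by apply: eq_bigr => i _; rewrite termX.
- by move=> r s; rewrite ore_termM.
Qed.

End OreExtension.

Lemma graded_derivation (R : nzRingType) (f : R -> R) (a b : R) :
  (\0 : R -> R) (a * b) = f a * (\0 : R -> R) b + (\0 : R -> R) a * b.
Proof. by rewrite /= mulr0 mul0r addr0. Qed.

Definition graded (R : nzRingType) (n : nat) (D : ore_data R n) :
    ore_data R n.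
Proof.
exact: (@OreData R n (alpha D) (fun=> \0) (@alpha_inj _ _ D)
  (fun i a b => graded_derivation (alpha D i) a b) (alphaC D)
  (fun _ _ _ => erefl) (fun i j _ a => raddf0 (alpha D j))).
Defined.

Notation graded_ext D := (ore_ext (graded D)).

Lemma graded_mulE (R : nzRingType) (n : nat) (D : ore_data R n)
    (a b : R) (s t : 'X_{1..n}) :
  (a *: ore_term (graded D) s) * (b *: ore_term (graded D) t)
  = (a * alphaT D s b) *: ore_term (graded D) (s + t)%MM.
Proof.
rewrite [LHS]ore_mul_term -scalerA; congr (_ *: _).
elim/mnm_ind: s => [|i s IHs]; first by rewrite /alphaT !mnm_iter0 add0m.
rewrite /alphaT (mnm_iterS (@ore_lmulYC _ _ _)) IHs (mnm_iterS (alphaC D)).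
by rewrite ore_lmulY_term /= scale0r addr0 -!addmA (addmC t).
Qed.

(* Terms t e_i of the free module of rank m, as pairs (t, i).                 *)
Notation mterm n m := ('X_{1..n} * 'I_m)%type.

Definition mterm_mul (n m : nat) (s : 'X_{1..n}) (x : mterm n m) : mterm n m :=
  ((s + x.1)%MM, x.2).

Definition mterm_dvd (n m : nat) (x y : mterm n m) : bool :=
  (x.2 == y.2) && (x.1 <= y.1)%MM.

Record well_order (T : eqType) (le : rel T) : Prop := WellOrder {
  wo_refl : reflexive le;
  wo_anti : antisymmetric le;
  wo_trans : transitive le;
  wo_total : total le;
  wo_wf : well_founded (fun x y => (x != y) && le x y)
}.

Definition term_order (n : nat) (leT : rel 'X_{1..n}) : Prop :=
  well_order leT /\ forall r s t, leT s t -> leT (r + s)%MM (r + t)%MM.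

Definition mterm_order (n m : nat) (leT : rel 'X_{1..n})
    (le : rel (mterm n m)) : Prop :=
  [/\ well_order le,
      forall r x y, le x y -> le (mterm_mul r x) (mterm_mul r y)
    & forall s t x, leT s t -> le (mterm_mul s x) (mterm_mul t x)].

Section LeadingMonomials.
Context (R : nzRingType) (n : nat) (D : ore_data R n) (m : nat).
Context (le : rel (mterm n m)).
Implicit Types f : 'rV[ore_ext D]_m.

Definition mcoef f (x : mterm n m) : R := (f 0 x.2 : {mpoly R[n]})@_x.1.

Definition mterms f : seq (mterm n m) :=
  [seq (t, i) | i <- enum 'I_m, t <- msupp (f 0 i : {mpoly R[n]})].

(* T(f); None only for f = 0.                                                 *)
Definition max_term f : option (mterm n m) :=
  ohead (sort (fun x y => le y x) (mterms f)).

(* M(f) as the pair (lc(f), T(f)).                                            *)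
Definition max_monomial f : option (R * mterm n m) :=
  omap (fun x => (mcoef f x, x)) (max_term f).

Lemma mem_mterms f x : (x \in mterms f) = (mcoef f x != 0).
Proof.
rewrite /mcoef -mcoeff_msupp; case: x => t i /=.
apply/allpairsPdep/idP => [[j [s [_ st [-> ->]]]] //|ti].
by exists i, t; rewrite mem_enum.
Qed.

Lemma max_termP leT f : mterm_order leT le -> f != 0 ->
  exists x, [/\ max_term f = Some x, mcoef f x != 0
             & forall y, mcoef f y != 0 -> le y x].
Proof.
case=> -[lexx _ le_trans le_tot _] _ _ f0.
have ge_tot : total (fun x y => le y x) by move=> x y; exact: le_tot.
have ge_trans : transitive (fun x y => le y x).
  by move=> y x z xy yz; exact: le_trans yz xy.
rewrite /max_term; have := sort_sorted ge_tot (mterms f).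
have := mem_sort (fun x y => le y x) (mterms f).
case: (sort _ _) => [|x s] mem_s /= ; last first.
  rewrite path_sortedE // => /andP[/allP xs _]; exists x; split=> //.
    by rewrite -mem_mterms -mem_s mem_head.
  move=> y; rewrite -mem_mterms -mem_s inE => /predU1P[->|/xs] //.
case/eqP: f0; apply/rowP => i; rewrite mxE; apply/mpolyP => t.
apply/eqP; rewrite [X in _ == X]mcoeff0; have := mem_mterms f (t, i).
by rewrite -mem_s in_nil => /esym/negbFE.
Qed.

End LeadingMonomials.

Section GebauerMoller.
Context (R : nzRingType) (n : nat) (D : ore_data R n) (m u : nat).
Context (le : rel (mterm n m)) (g : 'I_u -> 'rV[ore_ext D]_m).

(* M(f), read in the free module over the associated graded Ore extension.    *)
Definition max_monomial_vec (f : 'rV[ore_ext D]_m) : 'rV[graded_ext D]_m :=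
  if max_monomial le f is Some (c, (t, l))
  then (c *: ore_term (graded D) t) *: delta_mx 0 l else 0.

Definition sL (h : 'rV[graded_ext D]_u) : 'rV[graded_ext D]_m :=
  \sum_i h 0 i *: max_monomial_vec (g i).

Definition homogeneous (h : 'rV[graded_ext D]_u) : Prop :=
  exists (a : 'I_u -> R) (lam : 'I_u -> 'X_{1..n}),
    h = \row_i (a i *: ore_term (graded D) (lam i)) /\
    forall i j, a i != 0 -> a j != 0 ->
      omap (mterm_mul (lam i)) (max_term le (g i))
      = omap (mterm_mul (lam j)) (max_term le (g j)).

Definition gebauer_moller_set (G : 'rV[graded_ext D]_u -> Prop) : Prop :=
  (forall h, G h -> homogeneous h) /\ generates G (fun h => sL h = 0).

End GebauerMoller.

Section LcmTerms.
Context (R : nzRingType) (n : nat) (D : ore_data R n) (m u : nat).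
Context (c : 'I_u -> R) (tau : 'I_u -> 'X_{1..n}) (l : 'I_u -> 'I_m).

Definition lcm_term (x : mterm n m) : Prop :=
  exists H : {set 'I_u},
    [/\ H != set0, forall i, i \in H -> l i = x.2
      & x.1 = \big[@mlcm n/0%MM]_(i in H) tau i].

Definition cofactor_term (x : mterm n m) (i : 'I_u) : graded_ext D :=
  if mterm_dvd (tau i, l i) x then ore_term (graded D) (x.1 - tau i)%MM else 0.

Definition cofactor_coef (x : mterm n m) (i : 'I_u) : R :=
  if mterm_dvd (tau i, l i) x then alphaT D (x.1 - tau i)%MM (c i) else 0.

Definition coef_syzygy (x : mterm n m) (d : 'rV[R]_u) : Prop :=
  \sum_i d 0 i * cofactor_coef x i = 0.

Definition lifted_syzygy (x : mterm n m) (d : 'rV[R]_u) : 'rV[graded_ext D]_u :=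
  \row_i (d 0 i *: cofactor_term x i).

End LcmTerms.

(* Main.v *)
Require Import Defs.
From mathcomp Require Import all_boot all_order all_algebra.
Import GRing.Theory.
Local Open Scope ring_scope.

(* A syzygy splits into homogeneous components. The component of degree [w]   *)
(* involves only the [i] with T(g_i) dividing [w]; let [x], which divides [w],*)
(* be the lcm of these T(g_i). Since [alpha_{w/tau_i}] is the composite of    *)
(* [alpha_{w/x}] and [alpha_{x/tau_i}], and [alpha_{w/x}] is bijective, the   *)
(* component is [w/x] times the lift of a syzygy over R of the v(x)_i, hence  *)
(* lies in the span of S(x).                                                  *)

Set Implicit Arguments.
Unset Strict Implicit.
Unset Printing Implicit Defensive.

(** In the graded extension monomials multiply to monomials ([graded_mulE]), so [sL h = 0] amounts
    to one linear equation over [R] for each term [w], namely [hom_syzygy]. Every [h] is a finite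
    sum of its components ([component_sum]), and [component_lifted] pulls the equation at [w] back
    to the one at [lcm_dividing w], whose solutions are spanned by [C]. Conversely, [sL] is left
    linear and maps the lift of [d] at [x] to the monomial with term [x] and coefficient
    [\sum_i d_i v(x)_i], which vanishes. *)

Section LeftSpan.
Context (K : nzRingType) (V : lmodType K) (G : V -> Prop).

Lemma left_span_gen x : G x -> left_span G x.
Proof.
move=> Gx; exists [:: (1, x)]; split; last by rewrite big_seq1 scale1r.
by move=> p /[!inE] /eqP ->.
Qed.

Lemma left_span0 : left_span G 0.
Proof. by exists [::]; rewrite big_nil. Qed.

Lemma left_spanD x y : left_span G x -> left_span G y -> left_span G (x + y).
Proof.
move=> [s [Gs ->]] [t [Gt ->]]; exists (s ++ t); rewrite big_cat; split=> // p.
by rewrite mem_cat => /orP[/Gs | /Gt].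
Qed.

Lemma left_spanZ a x : left_span G x -> left_span G (a *: x).
Proof.
move=> [s [Gs ->]]; exists [seq (a * p.1, p.2) | p <- s]; split.
  by move=> _ /mapP[p /Gs ? ->].
by rewrite big_map scaler_sumr; apply: eq_bigr => p _; rewrite scalerA.
Qed.

Lemma left_span_sum (I : eqType) (s : seq I) (F : I -> V) :
  (forall i, i \in s -> left_span G (F i)) -> left_span G (\sum_(i <- s) F i).
Proof.
elim: s => [|i s IHs] GF; first by rewrite big_nil; exact: left_span0.
rewrite big_cons; apply: left_spanD; first exact/GF/mem_head.
by apply: IHs => j js; apply: GF; rewrite inE js orbT.
Qed.

End LeftSpan.

(** * The twists [alphaT] as a monoid action on [R] *)

Section AlphaT.
Context (R : nzRingType) (n : nat) (D : ore_data R n).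
Implicit Types s t : 'X_{1..n}.

Lemma alphaT0m a : alphaT D 0%MM a = a.
Proof. exact: mnm_iter0. Qed.

Lemma alphaTS i t a : alphaT D (t + U_(i))%MM a = alpha D i (alphaT D t a).
Proof. exact: (mnm_iterS (alphaC D)). Qed.

Lemma alphaTDm s t a : alphaT D (s + t)%MM a = alphaT D s (alphaT D t a).
Proof.
elim/mnm_ind: s => [|i s IHs]; first by rewrite add0m alphaT0m.
by rewrite -addmA (addmC U_(i)%MM) addmA !alphaTS IHs.
Qed.

Lemma alphaT0 t : alphaT D t 0 = 0.
Proof.
by elim/mnm_ind: t => [|i t IHt]; rewrite ?alphaT0m // alphaTS IHt rmorph0.
Qed.

Lemma alphaTD t : {morph alphaT D t : a b / a + b}.
Proof.
move=> a b; elim/mnm_ind: t => [|i t IHt]; first by rewrite !alphaT0m.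
by rewrite !alphaTS IHt rmorphD.
Qed.

Lemma alphaTM t : {morph alphaT D t : a b / a * b}.
Proof.
move=> a b; elim/mnm_ind: t => [|i t IHt]; first by rewrite !alphaT0m.
by rewrite !alphaTS IHt rmorphM.
Qed.

(** This lets coefficients at [w] be pulled back along the twist by [w/x]. *)
Lemma alphaT_bij t : (forall i, bijective (alpha D i)) -> bijective (alphaT D t).
Proof.
move=> alpha_bij; elim/mnm_ind: t => [|i t IHt].
  by exists id => a; rewrite ?alphaT0m.
by apply: eq_bij (bij_comp (alpha_bij i) IHt) _ _ => a; rewrite alphaTS.
Qed.

End AlphaT.

(** * Coefficients of Ore polynomials and of graded products *)

Section Coefficients.
Context (R : nzRingType) (n : nat) (D : ore_data R n).
Implicit Types (f : ore_ext D) (t : 'X_{1..n}).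

Definition ore_coef t f : R := (f : {mpoly R[n]})@_t.

Lemma ore_coef0 t : ore_coef t 0 = 0.
Proof. exact: mcoeff0. Qed.

Lemma ore_coefD t : {morph ore_coef t : f f' / f + f'}.
Proof. by move=> f f'; exact: mcoeffD. Qed.

Lemma ore_coef_sum t I (s : seq I) (P : pred I) (F : I -> ore_ext D) :
  ore_coef t (\sum_(i <- s | P i) F i) = \sum_(i <- s | P i) ore_coef t (F i).
Proof. exact: (big_morph _ (ore_coefD t) (ore_coef0 t)). Qed.

Lemma ore_coef_term t a s :
  ore_coef t (a *: ore_term D s) = if s == t then a else 0.
Proof.
rewrite [LHS]mcoeffZ mcoeffX.
by case: eqVneq => _; rewrite ?mulr1 ?mulr0.
Qed.

Lemma ore_coefP f f' : (forall t, ore_coef t f = ore_coef t f') -> f = f'.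
Proof. by move=> eq_ff'; apply/mpolyP => t; exact: eq_ff'. Qed.

End Coefficients.

(** Terms are cancellative, so only the monomial of [f] at [w - s] can reach [w]. *)
Lemma graded_coefM (R : nzRingType) (n : nat) (D : ore_data R n)
    (w s : 'X_{1..n}) (f : graded_ext D) (c : R) :
  ore_coef w (f * (c *: ore_term (graded D) s))
  = if (s <= w)%MM then ore_coef (w - s)%MM f * alphaT D (w - s)%MM c else 0.
Proof.
elim/ore_ind: f => [|f f' IHf IHf'|a t].
- by rewrite mul0r !ore_coef0 mul0r if_same.
- rewrite mulrDl !ore_coefD IHf IHf'; case: ifP; rewrite ?addr0 //.
  by rewrite mulrDl.
rewrite graded_mulE !ore_coef_term.
have [<-|tsw] := eqVneq (t + s)%MM w; first by rewrite lem_addl addmK eqxx.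
case: ifP => // le_sw; case: eqVneq => [tw|_]; last by rewrite mul0r.
by rewrite tw submK ?eqxx in tsw.
Qed.

Lemma big_mlcm_dvd (n : nat) (I : finType) (P : pred I) (F : I -> 'X_{1..n}) t :
  (\big[@mlcm n/0%MM]_(i | P i) F i <= t)%MM
  = [forall (i | P i), (F i <= t)%MM].
Proof.
rewrite -big_andE; apply: (big_morph (fun s => (s <= t)%MM)) => [r s|].
  exact: lem_mlcm.
by apply/mnm_lepP => i; rewrite mnm0E.
Qed.

(** * Splitting by degree and descent to lcm terms *)

Section HomogeneousComponents.
Context (R : nzRingType) (n : nat) (D : ore_data R n) (m u : nat).
Context (c : 'I_u -> R) (tau : 'I_u -> 'X_{1..n}) (l : 'I_u -> 'I_m).
Implicit Types (h : 'rV[graded_ext D]_u) (x w : mterm n m) (d : 'rV[R]_u).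

(** Lifting is [R]-linear because coefficients stand to the left of the terms; hence generators over
    [R] lift to generators of all lifts at [x]. *)
Lemma lifted_syzygy_sum x (s : seq (R * 'rV[R]_u)) :
  lifted_syzygy D tau l x (\sum_(p <- s) p.1 *: p.2)
  = \sum_(p <- s) p.1%:A *: lifted_syzygy D tau l x p.2.
Proof.
apply/rowP => i; rewrite !(mxE, summxE) scaler_suml; apply: eq_bigr => p _.
by rewrite !mxE -scalerA -scalerAl mul1r.
Qed.

Definition component h w : 'rV[graded_ext D]_u :=
  \row_i (if mterm_dvd (tau i, l i) w
          then ore_coef (w.1 - tau i)%MM (h 0 i)
               *: ore_term (graded D) (w.1 - tau i)%MM
          else 0).

Lemma component_sum h : exists s, h = \sum_(w <- s) component h w.
Proof.
(* These are the degrees met by the monomials of [h]; [undup] makes each one count once. *)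
exists (undup [seq ((t + tau i)%MM, l i) | i <- enum 'I_u,
                   t <- msupp (h 0 i : {mpoly R[n]})]).
apply/rowP => i; rewrite summxE; apply: ore_coefP => t.
set s := undup _; rewrite ore_coef_sum.
(* For fixed [i], the monomial of [h_i] at [t] belongs to exactly one degree. *)
have comp_coef w : ore_coef t (component h w 0 i) =
    if w == ((t + tau i)%MM, l i) then ore_coef t (h 0 i) else 0.
  rewrite mxE /mterm_dvd; case: w => w k /=; rewrite xpair_eqE (eq_sym k).
  have [_|_] /= := eqVneq (l i) k; rewrite ?andbT ?andbF ?ore_coef0 //.
  have [->|wt] := eqVneq w (t + tau i)%MM.
    by rewrite lem_addl addmK ore_coef_term eqxx.
  case: ifP => [le_w|_]; rewrite ?ore_coef0 // ore_coef_term.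
  by case: eqVneq => // wt'; rewrite -wt' submK ?eqxx in wt.
rewrite (eq_bigr _ (fun w _ => comp_coef w)).
have [ts|ts] := boolP (((t + tau i)%MM, l i) \in s).
  rewrite (bigD1_seq _ ts) ?undup_uniq //= eqxx big1 ?addr0 // => w.
  by move/negPf => ->.
rewrite big1_seq => [|w /= ws]; last by rewrite (negPf (memPn ts w ws)).
apply/eqP; apply: contraNT ts => ht; rewrite mem_undup; apply/allpairsPdep.
by exists i, t; rewrite mem_enum mcoeff_msupp.
Qed.

(** The left side is the coefficient of [w] in the image of [h] under [sL]. *)
Definition hom_syzygy h w : Prop :=
  \sum_(i | mterm_dvd (tau i, l i) w)
    ore_coef (w.1 - tau i)%MM (h 0 i) * alphaT D (w.1 - tau i)%MM (c i) = 0.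

(** This is T(H) for the largest possible [H]. If no T(g_i) divides [w], the empty lcm gives the
    term 1. *)
Definition lcm_dividing w : mterm n m :=
  (\big[@mlcm n/0%MM]_(i | mterm_dvd (tau i, l i) w) tau i, w.2).

Lemma lcm_dividing_le w : ((lcm_dividing w).1 <= w.1)%MM.
Proof. by rewrite big_mlcm_dvd; apply/forall_inP => i /andP[]. Qed.

(** Hence the equations at [w] and at its lcm involve the same indices. *)
Lemma dvd_lcm_dividing w i :
  mterm_dvd (tau i, l i) (lcm_dividing w) = mterm_dvd (tau i, l i) w.
Proof.
apply/idP/idP => [/andP[/= li le_i]|iw].
  by rewrite /mterm_dvd /= li (lepm_trans le_i (lcm_dividing_le w)).
have /andP[/= li _] := iw; rewrite /mterm_dvd /= li.
have := lepm_refl (lcm_dividing w).1; rewrite {1}/lcm_dividing big_mlcm_dvd.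
by move/forall_inP; exact.
Qed.

Lemma lcm_dividing_lcm_term w i :
  mterm_dvd (tau i, l i) w -> lcm_term tau l (lcm_dividing w).
Proof.
move=> iw; exists [set i | mterm_dvd (tau i, l i) w]; split.
- by apply/set0Pn; exists i; rewrite inE.
- by move=> j; rewrite inE => /andP[/eqP].
- by apply: eq_bigl => j; rewrite inE.
Qed.

Lemma component_lifted h w : (forall i, bijective (alpha D i)) ->
    hom_syzygy h w ->
  exists2 b, coef_syzygy D c tau l (lcm_dividing w) b
  & component h w = ore_term (graded D) (w.1 - (lcm_dividing w).1)%MM
                    *: lifted_syzygy D tau l (lcm_dividing w) b.
Proof.
move=> alpha_bij syz_h; set x := lcm_dividing w; set s := (w.1 - x.1)%MM.
have [ainv alphaK ainvK] := alphaT_bij s alpha_bij.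
have splitE i : mterm_dvd (tau i, l i) w ->
    (w.1 - tau i = s + (x.1 - tau i))%MM.
  rewrite -dvd_lcm_dividing => /andP[_ /= le_i].
  by rewrite addmBA // submK // lcm_dividing_le.
exists (\row_i (if mterm_dvd (tau i, l i) w
                then ainv (ore_coef (w.1 - tau i)%MM (h 0 i)) else 0)).
  (* Applying the injective twist by [s = w/x] turns the equation at [x] into [syz_h]. *)
  apply: (can_inj alphaK); rewrite alphaT0 -[RHS]syz_h [RHS]big_mkcond /=.
  rewrite (big_morph _ (alphaTD D s) (alphaT0 D s)).
  apply: eq_bigr => i _; rewrite mxE /cofactor_coef dvd_lcm_dividing.
  case: ifP => [iw|_]; last by rewrite mul0r alphaT0.
  by rewrite alphaTM ainvK -alphaTDm -splitE.
apply/rowP => i; rewrite !mxE /cofactor_term dvd_lcm_dividing.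
case: ifP => [iw|_]; last by rewrite scaler0 mulr0.
rewrite -[X in X * _]scale1r graded_mulE mul1r.
by rewrite -[alphaT _ _ _]/(alphaT D s _) ainvK -splitE.
Qed.

End HomogeneousComponents.

Theorem lemma43 (R : nzRingType) (R_domain : domain R)
    (R_zacharias : left_zacharias R)
    (n : nat) (D : ore_data R n)
    (alpha_auto : forall i, bijective (alpha D i))
    (m u : nat) (leT : rel 'X_{1..n}) (le : rel ('X_{1..n} * 'I_m))
    (leT_order : term_order leT) (le_order : mterm_order leT le)
    (g : 'I_u -> 'rV[ore_ext D]_m) (g_neq0 : forall i, g i != 0)
    (c : 'I_u -> R) (tau : 'I_u -> 'X_{1..n}) (l : 'I_u -> 'I_m)
    (g_monomial : forall i,
       max_monomial le (g i) = Some (c i, (tau i, l i)))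
    (C : 'X_{1..n} * 'I_m -> seq 'rV[R]_u)
    (C_generates : forall x, lcm_term tau l x ->
       generates (fun d => d \in C x) (coef_syzygy D c tau l x)) :
  gebauer_moller_set le g
    (fun h => exists x d, [/\ lcm_term tau l x, d \in C x
                            & h = lifted_syzygy D tau l x d]).
Proof.
pose mv i := (c i *: ore_term (graded D) (tau i)) *: delta_mx 0 (l i)
  : 'rV[graded_ext D]_m.
have sLE h : sL le g h = \sum_i h 0 i *: mv i.
  by apply: eq_bigr => i _; rewrite /max_monomial_vec g_monomial.
have sLD h k : sL le g (h + k) = sL le g h + sL le g k.
  by rewrite !sLE -big_split; apply: eq_bigr => i _; rewrite mxE scalerDl.
have sLZ a h : sL le g (a *: h) = a *: sL le g h.
  by rewrite !sLE scaler_sumr; apply: eq_bigr => i _; rewrite mxE scalerA.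
have sL_coef h (w : 'X_{1..n} * 'I_m) : ore_coef w.1 (sL le g h 0 w.2) =
    \sum_(i | mterm_dvd (tau i, l i) w)
      ore_coef (w.1 - tau i)%MM (h 0 i) * alphaT D (w.1 - tau i)%MM (c i).
  rewrite sLE summxE ore_coef_sum [RHS]big_mkcond; apply: eq_bigr => i _ /=.
  rewrite !mxE eqxx /mterm_dvd /= [w.2 == _]eq_sym.
  by case: eqP => _; rewrite /= ?mulr1 ?graded_coefM // !mulr0 ore_coef0.
have max_termE i : max_term le (g i) = Some (tau i, l i).
  by have := g_monomial i; rewrite /max_monomial; case: max_term => //= x [_ ->].
split=> [h [x [d [_ _ ->]]]|h].
  (* Where T(g_i) does not divide [x], the truncated [x.1 - tau i] is not a cofactor; the zero
     coefficient exempts it from the homogeneity condition. *)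
  exists (fun i => if mterm_dvd (tau i, l i) x then d 0 i else 0).
  exists (fun i => x.1 - tau i)%MM; split.
    apply/rowP => i; rewrite !mxE /cofactor_term.
    by case: ifP; rewrite ?scaler0 ?scale0r.
  have termE i : mterm_dvd (tau i, l i) x ->
      omap (mterm_mul (x.1 - tau i)%MM) (max_term le (g i)) = Some x.
    case: x => x k /andP[/= /eqP <- le_x].
    by rewrite max_termE /= /mterm_mul /= submK.
  move=> i j; case: ifP => [ix _|]; last by rewrite eqxx.
  by case: ifP => [jx _|]; [rewrite !termE | rewrite eqxx].
split=> [sLh0|[s [Gs ->]]]; last first.
  have sL0 : sL le g 0 = 0 by rewrite -[X in sL le g X](scale0r 0) sLZ scale0r.
  rewrite (big_morph _ sLD sL0) big_seq big1 // => -[a k] /Gs /=.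
  move=> [x [d [x_lcm dC ->]]]; rewrite sLZ.
  suff -> : sL le g (lifted_syzygy D tau l x d) = 0 by rewrite scaler0.
  have syz_d : coef_syzygy D c tau l x d.
    exact/(C_generates x x_lcm d).2/left_span_gen.
  rewrite sLE.
  (* All nonzero products share the term [x], so the sum over [R] factors out. *)
  transitivity (\sum_i ((d 0 i * cofactor_coef D c tau l x i)
      *: ore_term (graded D) x.1) *: delta_mx 0 x.2 : 'rV[graded_ext D]_m).
    apply: eq_bigr => i _; rewrite mxE /cofactor_term /cofactor_coef /mv.
    case: ifP => [/andP[/= /eqP -> le_x]|_].
      by rewrite scalerA graded_mulE submK.
    by rewrite mulr0 scaler0 !scale0r.
  by rewrite -scaler_suml -scaler_suml syz_d !scale0r.
have [s ->] := component_sum tau l h; apply: left_span_sum => w _.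
have syz_h : hom_syzygy c tau l h w.
  by rewrite /hom_syzygy -sL_coef sLh0 mxE ore_coef0.
have [b syz_b ->] := component_lifted alpha_auto syz_h.
apply: left_spanZ.
(* If nothing divides [w], [C_generates] may not apply at the empty lcm, but then the lift is
   zero. *)
case: (pickP (fun i => mterm_dvd (tau i, l i) w)) => [i iw|no_dvd]; last first.
  suff -> : lifted_syzygy D tau l (lcm_dividing tau l w) b = 0.
    exact: left_span0.
  by apply/rowP => i; rewrite !mxE /cofactor_term dvd_lcm_dividing no_dvd scaler0.
have x_lcm := lcm_dividing_lcm_term iw.
have [t [Ct ->]] := (C_generates _ x_lcm b).1 syz_b.
rewrite lifted_syzygy_sum; apply: left_span_sum => p pt.
apply/left_spanZ/left_span_gen; exists (lcm_dividing tau l w), p.2.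
by split=> //; exact: Ct.
Qed.
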